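(* For each integer $k\ge 0$, let $\{(a_n,b_n)\}_{n\ge 0}$ be the $k$-sequence of $\mathcal{F}$-Wythoff. Then $$\{a_n\mid n\ge 0\}\cup\{b_n\mid n\ge 0\}=\mathbb{Z}_{\ge 0}\qquad\text{and}\qquad \bigl|\{a_n\mid n\ge 0\}\cap\{b_n\mid n\ge 0\}\bigr|\le 2.$$
   Context: $\mathbb{Z}_{\ge 0}$ is the set of nonnegative integers, $|S|$ is the number of elements of $S$, and $\lfloor\cdot\rfloor$ is the integer part. A position is an unordered pair $(a,b)$ of nonnegative integers (two piles of tokens); $(a,b)$ is identified with $(b,a)$. $\mathcal{F}$-Wythoff is the impartial game with the following legal moves: (i) remove any positive number of tokens from one pile; (ii) remove the same positive number $k$ of tokens from both piles, provided the integer ratio of the two entries does not change, i.e. from $(a,b)$ with $1\le a\le b$ one may move to $(a-k,b-k)$ with $1\le k<a$ if $\lfloor (b-k)/(a-k)\rfloor=\lfloor b/a\rfloor$. The followers of $p$ are the positions reachable from $p$ by one legal move. For a finite set $S$ of nonnegative integers, $\mathrm{mex}(S)$ is the smallest nonnegative integer not in $S$ (so $\mathrm{mex}\,\emptyset=0$). The Sprague-Grundy value is defined inductively by $\mathcal{G}(p)=\mathrm{mex}\{\mathcal{G}(q)\mid q \text{ is a follower of } p\}$. The $k$-sequence of $\mathcal{F}$-Wythoff is the sequence $\{(a_n,b_n)\}_{n\ge 0}$ of all positions whose Sprague-Grundy value is $k$, written so that $0\le a_n\le b_n$ and $a_n<a_m$ for $n<m$. *)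

(* Defs.v *)
From mathcomp Require Import all_boot.
From mathcomp Require Import zify.

Set Implicit Arguments.
Unset Strict Implicit.
Unset Printing Implicit Defensive.

Lemma mex_exists (S : seq nat) : exists n, n \notin S.
Proof.
exists (\max_(i <- S) i).+1; apply/negP => inS.
by have := @leq_bigmax_seq _ S xpredT id _ inS isT; rewrite ltnn.
Qed.

Definition mex (S : seq nat) : nat := ex_minn (mex_exists S).

(* A position is the unordered pair of its two piles.  It is represented by
   either of the two corresponding ordered pairs; [grundyC] below shows that
   the choice is immaterial. *)
Definition position : Type := (nat * nat)%type.

(* The integer ratio floor(b / a) for 1 <= a <= b, in either order of a, b. *)
Definition ratio (a b : nat) : nat := maxn a b %/ minn a b.

(* In a diagonal move 1 <= k < min(a, b), so that both piles stay nonempty. *)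
Definition followers (p : position) : seq position :=
  let: (a, b) := p in
  [seq (i, b) | i <- iota 0 a] ++
  [seq (a, j) | j <- iota 0 b] ++
  [seq (a - k, b - k) | k <- iota 1 (minn a b).-1
                      & ratio (a - k) (b - k) == ratio a b].

(* The first argument is fuel: every move decreases the number of tokens, so
   [p.1 + p.2] units are enough.  The recursive equation is [grundyE]. *)
Fixpoint grundy_rec (n : nat) (p : position) : nat :=
  if n is n'.+1 then mex [seq grundy_rec n' q | q <- followers p] else 0.

Definition grundy (p : position) : nat := grundy_rec (p.1 + p.2) p.

Lemma followers_lt (p q : position) :
  q \in followers p -> q.1 + q.2 < p.1 + p.2.
Proof.
case: p => a b; rewrite !mem_cat => /or3P[] /mapP[i].
- by rewrite mem_iota => Hi -> /=; lia.
- by rewrite mem_iota => Hi -> /=; lia.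
- by rewrite mem_filter mem_iota => /andP[_ Hi] -> /=; lia.
Qed.

Lemma mex_nil : mex [::] = 0.
Proof. by rewrite /mex; case: ex_minnP => m _ /(_ 0 isT); case: m. Qed.

Lemma eq_mex (S T : seq nat) : S =i T -> mex S = mex T.
Proof. by move=> ST; apply: eq_ex_minn => n; rewrite ST. Qed.

Lemma grundy_rec_fuel (n m : nat) (p : position) :
  p.1 + p.2 <= n -> p.1 + p.2 <= m -> grundy_rec n p = grundy_rec m p.
Proof.
elim: n m p => [|n IHn] [|m] p //= pn pm.
- by case: p pn {pm} => [[|a] [|b]] //= _; rewrite mex_nil.
- by case: p pm {pn} => [[|a] [|b]] //= _; rewrite mex_nil.
by congr mex; apply/eq_in_map => q /followers_lt qp; apply: IHn; lia.
Qed.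

Lemma grundyE (p : position) :
  grundy p = mex [seq grundy q | q <- followers p].
Proof.
rewrite /grundy (@grundy_rec_fuel _ (p.1 + p.2).+1 p) //=.
congr mex; apply/eq_in_map => q /followers_lt qp.
by apply: grundy_rec_fuel; lia.
Qed.

Lemma followersC (a b x y : nat) :
  (x, y) \in followers (a, b) -> (y, x) \in followers (b, a).
Proof.
rewrite !mem_cat => /or3P[] /mapP[i Hi [-> ->]]; apply/or3P.
- by apply: Or32; apply/mapP; exists i.
- by apply: Or31; apply/mapP; exists i.
- apply: Or33; apply/mapP; exists i => //.
  by move: Hi; rewrite !mem_filter /ratio !(maxnC b) !(minnC b)
     (maxnC (b - i)) (minnC (b - i)).
Qed.

Lemma grundyC (a b : nat) : grundy (a, b) = grundy (b, a).
Proof.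
have [n] := ubnP (a + b); elim: n a b => // n IHn a b abn.
rewrite [LHS]grundyE [RHS]grundyE; apply: eq_mex => v.
apply/mapP/mapP => -[[x y] xy ->]; exists (y, x); try exact: followersC.
- by apply: IHn; have /= := followers_lt xy; lia.
- by apply: IHn; have /= := followers_lt xy; lia.
Qed.

(* The sequence (a n, b n) lists all positions of Sprague-Grundy value k, each
   written with its smaller pile first, by increasing smaller pile. *)
Definition k_sequence (k : nat) (a b : nat -> nat) : Prop :=
  [/\ forall n, a n <= b n,
      forall n m, n < m -> a n < a m,
      forall n, grundy (a n, b n) = k
    & forall x y, x <= y -> grundy (x, y) = k ->
        exists n, a n = x /\ b n = y].

(* Main.v *)
Require Import Defs.
From mathcomp Require Import all_boot.
From mathcomp Require Import boolp classical_sets cardinality.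
From mathcomp Require Import zify.

Local Open Scope classical_set_scope.

(** Row moves make the Grundy values of each row of the table pairwise distinct,
    and a row takes every value: far enough along row x, no entry of rows 0..x
    is at most k, so the entry there exceeds k and has a follower of value k,
    which must lie in row x. Hence the positions of value k form the graph of an
    involution s of the nonnegative integers, the a_n being the x with x <= s x
    and the b_n those with s x <= x. Common elements are the fixed points of s,
    i.e. the x with grundy (x, x) = k; all positive ones are joined by diagonal
    moves of ratio 1, so there is at most one besides x = 0. *)

Lemma mex_notin (S : seq nat) : mex S \notin S.
Proof. by rewrite /mex; case: ex_minnP. Qed.

Lemma lt_mex_mem (S : seq nat) (n : nat) : n < mex S -> n \in S.
Proof.
rewrite /mex; case: ex_minnP => m _ min_m; rewrite ltnNge.
by apply: contraNT => /min_m.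
Qed.

Lemma grundy_follower_neq (p q : position) :
  q \in followers p -> grundy q <> grundy p.
Proof.
move=> qp eq_qp; have := mex_notin [seq grundy r | r <- followers p].
by rewrite -grundyE -eq_qp map_f.
Qed.

Lemma lt_grundy_follower (p : position) (k : nat) :
  k < grundy p -> exists2 q, q \in followers p & grundy q = k.
Proof. by rewrite grundyE => /lt_mex_mem /mapP[q qp ->]; exists q. Qed.

Lemma grundy_row_inj (x : nat) : injective (fun y => grundy (x, y)).
Proof.
have row_neq y z : y < z -> grundy (x, y) <> grundy (x, z).
  move=> yz; apply: grundy_follower_neq; rewrite !mem_cat; apply/or3P/Or32.
  by apply: map_f; rewrite mem_iota.
move=> y z /= eq_yz; case: (ltngtP y z) => // /row_neq; first by case.
by rewrite eq_yz; case.
Qed.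

Lemma grundy_diag_inj (x y : nat) :
  0 < x -> 0 < y -> grundy (x, x) = grundy (y, y) -> x = y.
Proof.
have diag_neq u v : 0 < u < v -> grundy (u, u) <> grundy (v, v).
  move=> /andP[u0 uv]; apply: grundy_follower_neq.
  rewrite !mem_cat; apply/or3P/Or33/mapP; exists (v - u); last first.
    by congr pair; lia.
  rewrite mem_filter mem_iota /ratio !maxnn !minnn !divnn; lia.
move=> x0 y0 eq_xy; case: (ltngtP x y) => // lt_xy.
- by case: (diag_neq x y) => //; rewrite x0.
- by case: (diag_neq y x) => //; rewrite y0.
Qed.

(** By injectivity each of the finitely many values in [S] is taken at most once, so [N] only has to
    pass those arguments. *)
Lemma inj_eventually_notin (f : nat -> nat) (S : seq nat) :
  injective f -> exists N, forall j, N <= j -> f j \notin S.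
Proof.
move=> f_inj; elim: S => [|v S [N IH]]; first by exists 0.
have [[j0 <-]|nov] := pselect (exists j, f j = v).
  exists (maxn N j0.+1) => j; rewrite geq_max => /andP[Nj j0j].
  by rewrite in_cons negb_or IH // andbT (inj_eq f_inj); lia.
exists N => j Nj; rewrite in_cons negb_or IH // andbT.
by apply/eqP => fj; apply: nov; exists j.
Qed.

Lemma grundy_rows_eventually_notin (x : nat) (S : seq nat) :
  exists N, forall i j, i <= x -> N <= j -> grundy (i, j) \notin S.
Proof.
elim: x => [|x [N IH]].
  have [N HN] := @inj_eventually_notin _ S (@grundy_row_inj 0).
  by exists N => i j; rewrite leqn0 => /eqP->; apply: HN.
have [M HM] := @inj_eventually_notin _ S (@grundy_row_inj x.+1).
exists (maxn N M) => i j; rewrite geq_max leq_eqVlt.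
by move=> /orP[/eqP->|ix] /andP[Nj Mj]; [apply: HM | apply: IH].
Qed.

Lemma grundy_row_surj (k x : nat) : exists y, grundy (x, y) = k.
Proof.
have [N HN] := grundy_rows_eventually_notin x (iota 0 k.+1).
(* The offset [x] keeps diagonal moves far out: they remove fewer than [x] tokens from each pile, so
   the column stays at least [N]. *)
have lt_k : k < grundy (x, N + x).
  by have := HN x (N + x) (leqnn x) (leq_addr x N); rewrite mem_iota; lia.
have [[i j] ij gij] := lt_grundy_follower _ _ lt_k.
have far : ~ (i <= x /\ N <= j).
  by move=> [ix Nj]; have := HN i j ix Nj; rewrite gij mem_iota; lia.
move: ij; rewrite !mem_cat => /or3P[] /mapP[t Ht [ei ej]].
- by case: far; move: Ht; rewrite mem_iota; lia.
- by exists j; rewrite -ei.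
- by case: far; move: Ht; rewrite mem_filter mem_iota => /andP[_]; lia.
Qed.

Lemma grundy_partner (k : nat) :
  exists s : nat -> nat, forall x y, grundy (x, y) = k <-> y = s x.
Proof.
have [s sP] := choice (grundy_row_surj k).
exists s => x y; split=> [gxy|->]; last exact: sP.
by apply: (@grundy_row_inj x); rewrite /= sP.
Qed.

(** Iterate the map [nx] sending [N] to the least element of [P] that is at least [N]; minimality
    ensures that no element is skipped. *)
Lemma increasing_enumeration (P : nat -> Prop) :
  (forall N, exists2 x, N <= x & P x) ->
  exists a : nat -> nat,
    [/\ forall n m, n < m -> a n < a m, forall n, P (a n)
      & forall x, P x -> exists n, a n = x].
Proof.
move=> unbounded.
have next N : exists x, [/\ N <= x, P x & forall y, N <= y -> P y -> x <= y].
  have ex : exists x, (N <= x) && `[< P x >].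
    by have [x Nx Px] := unbounded N; exists x; rewrite Nx; apply/asboolP.
  case: (ex_minnP ex) => x /andP[Nx /asboolP Px] min_x.
  exists x; split=> // y Ny Py; apply: min_x.
  by rewrite Ny; apply/asboolP.
have [nx nxP] := choice next.
pose a n := iter n (fun x => nx x.+1) (nx 0).
have aS n : a n < a n.+1 by case: (nxP (a n).+1).
have a_lt n m : n < m -> a n < a m by apply: (homo_ltn ltn_trans) => i.
have le_a n : n <= a n by elim: n => // n /leq_ltn_trans; apply; apply: aS.
have below x n : P x -> x < a n -> exists m, a m = x.
  move=> Px; elim: n => [|n IH] x_lt.
    by have [_ _ /(_ x (leq0n x) Px)] := nxP 0; rewrite leqNgt x_lt.
  case: (ltngtP x (a n)) => [/IH//|lt_x|->]; last by exists n.
  by have [_ _ /(_ x lt_x Px)] := nxP (a n).+1; rewrite leqNgt x_lt.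
exists a; split=> // [[|n]|x Px].
- by case: (nxP 0).
- by case: (nxP (a n).+1).
- exact: (below x x.+1 Px (le_a x.+1)).
Qed.

Lemma k_sequence_exists (k : nat) :
  exists a b : nat -> nat, k_sequence k a b.
Proof.
have [s sP] := grundy_partner k.
have sK x : s (s x) = x by apply/esym/sP; rewrite grundyC; apply/sP.
have unbounded N : exists2 x, N <= x & x <= s x.
  (* This [y] exceeds [s i] for every [i < N], so [s y < N] would give [y = s (s y) < y]. The
     smaller of [y] and [s y] is then the required element. *)
  pose y := N + \max_(i < N) (s i).+1.
  have Nsy : N <= s y.
    rewrite leqNgt; apply/negP => syN.
    have := @leq_bigmax _ (fun i : 'I_N => (s i).+1) (Ordinal syN).
    by rewrite /= sK /y ltnNge leq_addl.
  have [ysy|syy] := leqP y (s y); first by exists y => //; apply: leq_addr.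
  by exists (s y) => //; rewrite sK ltnW.
have [a [a_lt a_le a_surj]] := increasing_enumeration _ unbounded.
exists a, (s \o a); split=> //= [n|x y xy /sP ey]; first exact/sP.
rewrite ey in xy *; have [n an] := a_surj x xy.
by exists n; rewrite an.
Qed.

Theorem corollary12 (k : nat) :
  (exists a b : nat -> nat, k_sequence k a b) /\
  (forall a b : nat -> nat, k_sequence k a b ->
     range a `|` range b = [set: nat] /\
     (range a `&` range b #<= `I_2)%card).
Proof.
split; first exact: k_sequence_exists.
move=> a b [a_le_b _ gab ab_surj]; split.
  apply/seteqP; split=> // x _; have [y gxy] := grundy_row_surj k x.
  case: (leqP x y) => [/ab_surj/(_ gxy)[n [<- _]]|/ltnW/ab_surj].
    by left; exists n.
  by rewrite grundyC => /(_ gxy)[n [_ <-]]; right; exists n.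
have diag x : (range a `&` range b) x -> grundy (x, x) = k.
  move=> [[n _ an] [m _ bm]]; have gx := gab n; have gy := gab m.
  rewrite an in gx; rewrite bm grundyC in gy.
  have bn : b n = a m by apply: (@grundy_row_inj x); rewrite /= gx.
  have ex : b n = x by have := a_le_b n; have := a_le_b m; lia.
  by rewrite ex in gx.
(* The bound 2 comes from injecting the common elements into [{0, 1}] by positivity. *)
have pos_inj : {in range a `&` range b &, injective (fun x => (0 < x) : nat)}.
  move=> x y /set_mem/diag gx /set_mem/diag gy.
  case: (posnP x) (posnP y) => [->|x0] [->|y0] //= _.
  by apply: grundy_diag_inj => //; rewrite gx gy.
rewrite -(card_le_eql (inj_card_eq pos_inj)); apply: subset_card_le.
by move=> _ [x _ <-] /=; case: (0 < x).
Qed.
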